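(* Let $G$ be a finite group, let $n$ be a positive integer and let $L$ be a non-empty subset of $G$. Then $|N_{n,L}|$ is a multiple of $\big[2^{(n, |C_G(L)|)}-1\big]^{|L|}$. In particular, if $|N_{n,L}|\neq 0$, then $|N_{n,L}|$ is an odd number.
   Context: For a non-empty subset $S$ of a group $G$ and a positive integer $n$, put $\mho^{\{n\}}(S)=\{s^n \mid s\in S\}$. For a non-empty subset $L$ of $G$, $N_{n,L}$ denotes the set of all non-empty subsets $S\subseteq G$ such that $\mho^{\{n\}}(S)=L$. $C_G(L)=\{g\in G \mid gl=lg \text{ for all } l\in L\}$ is the centralizer of the subset $L$ in $G$. For positive integers $a,b$, $(a,b)$ denotes their greatest common divisor. The number $0$ counts as a multiple of every integer. *)

(* Defs.v *)
From mathcomp Require Import all_boot all_fingroup.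
Set Implicit Arguments.
Unset Strict Implicit.
Unset Printing Implicit Defensive.

Local Open Scope group_scope.

(* This is the plain set of n-th powers, neither the subgroup generated by them
   nor the functor 'Mho^n of mathcomp.solvable.abelian. *)
Definition mho_set (gT : finGroupType) (n : nat) (S : {set gT}) : {set gT} :=
  [set s ^+ n | s in S].

(* N_{n,L}, relative to the ambient group G *)
Definition mho_fiber (gT : finGroupType) (G : {group gT}) (n : nat)
    (L : {set gT}) : {set {set gT}} :=
  [set S : {set gT} | [&& S != set0, S \subset G & mho_set n S == L]].

(* Main.v *)
(* A set S with S^n = L is a choice of a non-empty set of n-th roots of each l
   in L, so |N_{n,L}| is the product of the numbers 2^r(l) - 1, where r(l) is the
   number of n-th roots of l in G.  As 2^d - 1 divides 2^r - 1 when d divides r,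
   it suffices that gcd(n, |C_G(z)|) divides r(z) for every z.  This
   generalization of Frobenius' theorem (the case z = 1) is checked one prime p
   at a time: if the p-part of z is not 1, all of n_p divides r(z); otherwise
   the roots are sorted by their p'-parts y, and Frobenius' theorem is applied
   in each C_G(y). *)
Require Import Defs.
From mathcomp Require Import all_boot all_fingroup.
From mathcomp Require Import cyclic pgroup abelian frobenius.

Set Implicit Arguments.
Unset Strict Implicit.
Unset Printing Implicit Defensive.

Definition nroots (gT : finGroupType) (G : {set gT}) (n : nat) (z : gT) :=
  [set x in G | (x ^+ n == z)%g].

Section RootCount.
Local Open Scope group_scope.
Variable gT : finGroupType.
Implicit Types (G : {group gT}) (L : {set gT}) (n p : nat) (x y z : gT).

(** By Lagrange, x^n = 1 depends only on the gcd of n with |G|, so Frobenius' theorem for divisors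
    of |G| applies. *)
Lemma gcdn_dvd_card_Ldiv G n : gcdn n #|G| %| #|'Ldiv_n(G)|.
Proof.
have -> : 'Ldiv_n(G) = 'Ldiv_(gcdn n #|G|)(G).
  apply/setP=> x; rewrite !inE; case Gx: (x \in G) => //=.
  by rewrite -!order_dvdn dvdn_gcd order_dvdG // andbT.
by apply: Frobenius_Ldiv; apply: dvdn_gcdr.
Qed.

(** The p'-part of n is prime to the order of x_p, so only the power by n_p lowers that order. As
    the result is still non-trivial, each factor p of n_p divides the order out exactly once. *)
Lemma order_constt_root p n x : prime p -> 0 < n ->
  (x ^+ n).`_p != 1 -> #[x.`_p] = (n`_p * #[(x ^+ n).`_p])%N.
Proof.
move=> p_pr n_gt0 ntxn; set m := (n`_p^')%N.
have p_x : p.-elt x.`_p by apply: p_elt_constt.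
have ox : #[x.`_p ^+ m] = #[x.`_p].
  rewrite orderXgcd; suff /eqP-> : coprime #[x.`_p] m by rewrite divn1.
  exact: pnat_coprime p_x (part_pnat _ _).
rewrite -{1}ox p_part; apply: orderXpfactor => //.
  by rewrite -p_part -expgM mulnC partnC // consttX.
rewrite order_constt p_part; move: ntxn.
rewrite -order_eq1 order_constt p_part.
by case: logn => // k _; rewrite expnS dvdn_mulr.
Qed.

(* Writing b for the order of z_p, multiplying a root x by powers of x_p^b
   changes neither x^n nor the cyclic group <x_p^b>, which has order n_p. *)
Lemma partn_dvd_card_nroots G n p z : prime p -> 0 < n ->
  z.`_p != 1 -> n`_p %| #|nroots G n z|.
Proof.
move=> p_pr n_gt0 ntz; set b := #[z.`_p].
pose C x := <[x.`_p ^+ b]>.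
have pb : p %| b.
  move: ntz; rewrite -order_eq1 /b order_constt p_part.
  by case: logn => // k _; rewrite expnS dvdn_mulr.
rewrite -sum1_card (partition_big_imset (fun x => x *: C x)) /=.
apply: dvdn_sum => _ /imsetP[x Rx ->].
have [Gx /eqP xn] := setIdP Rx.
have ox : #[x.`_p] = (n`_p * b)%N.
  by rewrite (@order_constt_root p n) ?xn.
have oC : #|C x| = (n`_p)%N.
  rewrite -[#|C x|]/(#[_]) orderXdiv ox ?dvdn_mull // mulnK //.
  exact: order_gt0.
rewrite sum1dep_card.
suff -> : [set y in nroots G n z | y *: C y == x *: C x] = x *: C x.
  by rewrite card_lcoset oC.
apply/setP=> y; rewrite inE; apply/andP/idP => [[_ /eqP <-] | ].
  exact: lcoset_refl.
case/lcosetP=> _ /cycleP[k ->] ->{y}.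
set v := x.`_p ^+ b; have vx j : v ^+ j = x.`_p ^+ (b * j) by rewrite expgM.
have Gv : v ^+ k \in G by rewrite vx !groupX.
have cxv : commute x (v ^+ k) by rewrite vx; do 2!apply: commuteX.
have vn1 : v ^+ n = 1.
  apply/eqP; rewrite -order_dvdn -[#[v]]/#|C x| oC; exact: dvdn_part.
have pv : p.-elt v by apply/p_eltX/p_elt_constt.
(* The p-part of the new root is x_p^(1 + bk). Since p divides b, the exponent is prime to p, so the
   same cyclic group is generated. *)
have eC : C (x * v ^+ k) = C x.
  rewrite /C consttM // (constt_p_elt (p_eltX _ pv)) vx -expgS -expgM mulnC.
  rewrite expgM -/v; apply/esym/eqP; rewrite -/(generator <[v]> _).
  rewrite generator_coprime; apply: (@pnat_coprime p) => //.
  rewrite p'natE // -addn1 dvdn_addr ?dvdn_mulr // dvdn1.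
  by rewrite neq_ltn prime_gt1 ?orbT.
split.
  by rewrite inE groupM // expgMn // xn expgAC vn1 expg1n mulg1 eqxx.
by rewrite eC lcosetM lcoset_id ?mem_cycle.
Qed.

(* The fibres of x |-> x_p' over y are cosets of the p-parts, which solve
   u^(n_p) = 1 in C_G(y); Frobenius' theorem applies to each. *)
Lemma gcdn_partn_dvd_card_nroots G n p z : 0 < n ->
  z.`_p = 1 -> gcdn n`_p #|'C_G[z]| %| #|nroots G n z|.
Proof.
move=> n_gt0 z1; set H := 'C_G[z]%G.
pose F y := [set x in nroots G n z | x.`_p^' == y].
have zp' : z.`_p^' = z by rewrite -[RHS](consttC p) z1 mul1g.
(* C_G(z) permutes the roots by conjugation, so the p'-parts are grouped into C_G(z)-classes; one
   class is treated at a time. *)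
rewrite -[#|nroots G n z|]sum1_card (partition_big_imset (fun x => x.`_p^' ^: H)) /=.
apply: dvdn_sum => _ /imsetP[x Rx ->].
have [Gx /eqP xn] := setIdP Rx.
set y := x.`_p^'.
have Gy : y \in G by apply: groupX.
have yn : y ^+ n = z by rewrite -consttX xn.
have p'y : p^'.-elt y by apply: p_elt_constt.
rewrite (partition_big (fun x => x.`_p^') [in y ^: H]) /= => [|u]; last first.
  by case/andP=> _ /eqP <-; apply: class_refl.
have FE : F y = 'Ldiv_(n`_p)('C_G[y]) :* y.
  apply/setP=> u; rewrite mem_rcoset inE.
  apply/andP/idP => [[/setIdP[Gu /eqP un] /eqP uy]|].
    have -> : u * y^-1 = u.`_p by rewrite -{1}(consttC p u) uy mulgK.
    have cyu : commute y u.`_p by rewrite -uy; apply: commuteX2.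
    rewrite inE in_setI groupX //= cent1C; apply/andP; split; first exact/cent1P.
    rewrite inE -order_dvdn -(@Gauss_dvdl _ _ (n`_p^')%N).
      by rewrite partnC // order_dvdn -consttX un z1.
    exact: pnat_coprime (p_elt_constt p u) (part_pnat _ _).
  set w := u * y^-1; case/setIP=> /setIP[Gw /cent1P cwy].
  rewrite inE => /eqP wq.
  have -> : u = w * y by rewrite mulgKV.
  have wn : w ^+ n = 1 by rewrite -(partnC p n_gt0) expgM wq expg1n.
  have pw : p.-elt w.
    by apply: pnat_dvd (part_pnat p n); rewrite order_dvdn wq.
  rewrite inE groupM // expgMn // wn mul1g yn eqxx; split=> //.
  rewrite consttM // (constt_p_elt p'y).
  suff -> : w.`_p^' = 1 by rewrite mul1g.
  by apply/constt1P; rewrite p_eltNK.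
(* Conjugation by a in C_G(z) maps [F y] onto [F (y ^ a)], so all fibres over the class have equal
   size. *)
rewrite (eq_bigr (fun _ => #|F y|)) => [|_ /imsetP[a Ha ->]]; last first.
  have [Ga cza] := setIP Ha.
  rewrite -(cardJg (F y) a) -sum1_card; apply: eq_bigl => u.
  rewrite mem_conjg !inE groupJr ?groupV //.
  rewrite -conjXg consttJ !(can2_eq (conjgKV a) (conjgK a)).
  have -> : z ^ a = z.
    by apply/conjg_fixP/commgP/cent1P; rewrite cent1C.
  case: (u.`_p^' =P y ^ a) => [->|]; rewrite ?andbF // !andbT.
  by rewrite (classGidl _ Ha) eqxx andbT.
rewrite sum_nat_const FE card_rcoset.
(* Since z = y^n, the class of y has |H : C_G(y)| elements. *)
have sCH : 'C_G[y] \subset H.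
  rewrite subsetI subsetIl; apply/subsetP=> u /setIP[_ /cent1P cuy].
  by apply/cent1P; rewrite -yn; apply: commuteX.
have CHy : 'C_H[y] = 'C_G[y].
  by apply/eqP; rewrite eqEsubset setSI ?subsetIl //= subsetI sCH subsetIr.
rewrite -index_cent1 CHy.
(* The index i = |H : C_G(y)| is absorbed: i * gcd(n_p, |C_G(y)|) = gcd(i * n_p, |H|), a multiple of
   gcd(n_p, |H|). *)
apply: dvdn_trans (dvdn_mul (dvdnn _) (gcdn_dvd_card_Ldiv _ _)).
by rewrite muln_gcdr dvdn_gcd dvdn_mull ?dvdn_gcdl // mulnC Lagrange ?dvdn_gcdr.
Qed.

Lemma gcdn_dvd_card_nroots G n z : 0 < n ->
  gcdn n #|'C_G[z]| %| #|nroots G n z|.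
Proof.
move=> n_gt0; set d := gcdn _ _.
have d_gt0 : 0 < d by rewrite gcdn_gt0 n_gt0.
apply/dvdn_partP => // p; rewrite mem_primes => /andP[p_pr _].
have dn : d`_p %| n`_p by rewrite partn_dvd // dvdn_gcdl.
have [z1 | ntz] := eqVneq z.`_p 1; last first.
  exact: dvdn_trans dn (partn_dvd_card_nroots _ p_pr n_gt0 ntz).
apply: dvdn_trans (gcdn_partn_dvd_card_nroots G n_gt0 z1).
rewrite dvdn_gcd dn; apply: dvdn_trans (dvdn_part _ _) _; exact: dvdn_gcdr.
Qed.

Lemma card_mho_fiber G n L : L != set0 ->
  #|mho_fiber G n L| = (\prod_(l in L) (2 ^ #|nroots G n l|).-1)%N.
Proof.
move=> L_neq0; pose R l := nroots G n l.
pose D l : pred {set gT} := [pred A : {set gT} | (A \subset R l) && (A != set0)].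
pose U (f : {ffun gT -> {set gT}}) := \bigcup_(l in L) f l.
(* The sets [R l] are pairwise disjoint, since x determines x^n, so [U f] meets [R l] in [f l]
   only. *)
have UR f l : f \in pfamily set0 (mem L) D -> l \in L -> U f :&: R l = f l.
  case/pfamilyP=> _ Df Ll; apply/setP=> x; rewrite inE; apply/andP/idP.
    case=> /bigcupP[k Lk fkx] Rlx.
    have /andP[/subsetP/(_ x fkx)] := Df k Lk.
    by case/setIdP: Rlx => _ /eqP <-; rewrite inE => /andP[_ /eqP->].
  move=> flx; split; first by apply/bigcupP; exists l.
  by have /andP[/subsetP-> ] := Df l Ll.
(* Outside L the default value [set0] is forced, so f is determined everywhere. *)
have inj : {in pfamily set0 (mem L) D &, injective U}.
  move=> f g Df Dg eqU; apply/ffunP=> l.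
  have [Ll | L'l] := boolP (l \in L); first by rewrite -!UR // eqU.
  have [/supportP sf _] := pfamilyP Df; have [/supportP sg _] := pfamilyP Dg.
  by rewrite sf ?sg.
have <- : U @: pfamily set0 (mem L) D = mho_fiber G n L.
  apply/setP=> S; apply/imsetP/idP=> [[f Df ->] | ].
    have [_ Df'] := pfamilyP Df.
    have UL : mho_set n (U f) = L.
      apply/setP=> l; apply/imsetP/idP=> [[x /bigcupP[k Lk fkx] ->]|Ll].
        have /andP[/subsetP/(_ x fkx)] := Df' k Lk.
        by rewrite inE => /andP[_ /eqP->].
      have /andP[/subsetP sfR /set0Pn[x flx]] := Df' l Ll.
      exists x; first by apply/bigcupP; exists l.
      by have:= sfR x flx; rewrite inE => /andP[_ /eqP->].
    rewrite inE UL eqxx andbT; apply/andP; split.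
      apply: contra L_neq0 => /eqP U0.
      by rewrite -UL U0 /mho_set imset0.
    apply/bigcupsP=> l Ll; have /andP[sfR _] := Df' l Ll.
    by apply: subset_trans sfR _; apply/subsetP=> x /setIdP[].
  rewrite inE => /and3P[_ /subsetP sSG /eqP SL].
  exists [ffun l => if l \in L then S :&: R l else set0].
    apply/pfamilyP; split.
      by apply/supportP=> l L'l; rewrite ffunE (negPf L'l).
    move=> l Ll; rewrite ffunE Ll inE subsetIr /=.
    move: Ll; rewrite -SL => /imsetP[x Sx ->]; apply/set0Pn; exists x.
    by rewrite !inE Sx sSG //=.
  apply/setP=> x; apply/idP/bigcupP=> [Sx | [l Ll]]; last first.
    by rewrite ffunE Ll => /setIP[].
  have Lx : x ^+ n \in L by rewrite -SL; apply: imset_f.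
  by exists (x ^+ n); rewrite // ffunE Lx !inE Sx sSG //=.
rewrite card_in_imset // card_pfamily foldrE big_map big_enum /=.
apply: eq_bigr => l _.
rewrite -card_powerset (cardsD1 set0 (powerset _)) inE sub0set add1n /=.
by rewrite -cardsE; apply: eq_card => A; rewrite !inE andbC.
Qed.

End RootCount.

Theorem theorem2p3 (gT : finGroupType) (G : {group gT}) (n : nat)
    (L : {set gT}) (n_gt0 : 0 < n) (L_neq0 : L != set0) (sLG : L \subset G) :
  (2 ^ gcdn n #|'C_G(L)%g| - 1) ^ #|L| %| #|mho_fiber G n L|
  /\ (#|mho_fiber G n L| <> 0 -> odd #|mho_fiber G n L|).
Proof.
rewrite card_mho_fiber //; split.
  rewrite -prod_nat_const; apply: (big_ind2 dvdn) => //.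
    by move=> *; apply: dvdn_mul.
  move=> l Ll; rewrite subn1.
  have /dvdnP[k ->] : gcdn n #|'C_G(L)%g| %| #|nroots G n l|.
    apply: dvdn_trans (gcdn_dvd_card_nroots G l n_gt0).
    (* Since l lies in L, C_G(L) is a subgroup of C_G(l). *)
    rewrite dvdn_gcd dvdn_gcdl (dvdn_trans (dvdn_gcdr _ _)) //.
    by rewrite cardSg // setIS //= -cent_set1 centS // sub1set.
  by rewrite mulnC expnM dvdn_pred_predX.
move=> nz; apply: (big_ind odd) => // [a b|l Ll]; first by rewrite oddM => -> ->.
(* A factor with no roots would be 2^0 - 1 = 0, so every exponent is positive and every factor
   odd. *)
move: nz; rewrite (bigD1 l) //=; case: #|nroots G n l| => // k _.
by rewrite -subn1 oddB ?expn_gt0 // oddX.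
Qed.
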